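(* For every $A\subseteq\mathbb{N}$ that is not computably enumerable, the represented space $H_A$ is finite and computably Hausdorff, but not computably discrete.
   Context: A represented space $\mathbf{X}=(X,\delta_{\mathbf{X}})$ is a set $X$ with a partial surjection $\delta_{\mathbf{X}}:\subseteq\mathbb{N}^{\mathbb{N}}\to X$; any $p$ with $\delta_{\mathbf X}(p)=x$ is a name of $x$. A map $f:\mathbf{X}\to\mathbf{Y}$ is computable if some computable partial map on $\mathbb{N}^{\mathbb{N}}$ sends every name of every $x\in X$ to a name of $f(x)$. In the product $\mathbf{X}\times\mathbf{Y}$, $p$ names $(x,y)$ iff $n\mapsto p(2n)$ names $x$ and $n\mapsto p(2n+1)$ names $y$. Sierpinski space $\mathbb{S}=\{\top,\bot\}$ is represented so that $0^\omega$ names $\bot$ and every other sequence names $\top$. A subset of $\mathbf{X}$ is computably open if its characteristic function $\mathbf{X}\to\mathbb{S}$ (value $\top$ exactly on the set) is computable, and computably closed if its complement is computably open. $\mathbf{X}$ is computably discrete (computably Hausdorff) if the diagonal $\{(x,x)\}\subseteq\mathbf{X}\times\mathbf{X}$ is computably open (computably closed). An enumeration of a set $B\subseteq\mathbb{N}$ is a sequence $s:\mathbb{N}\to\mathbb{N}\uplus\{\bot\}$ with $B=\{s_n\mid n\in\mathbb{N},\ s_n\neq\bot\}$ (coded as an element of $\mathbb{N}^{\mathbb{N}}$, e.g. with $0$ for $\bot$ and $k+1$ for $k$). For non-empty $A\subsetneq\mathbb{N}$, $H_A$ is the represented space with underlying set $\{a,b\}$ (two distinct points) in which a name for $a$ is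 some $n\notin A$ followed by an enumeration of $A$, and a name for $b$ is some $n\in A$ followed by an enumeration of some (possibly empty) $B\subseteq\mathbb{N}\setminus A$. (A set that is not computably enumerable is automatically non-empty and different from $\mathbb{N}$.) *)

(* Defs.v *)
From mathcomp Require Import all_boot.
From mathcomp Require Import boolp classical_sets cardinality.

Set Implicit Arguments.
Unset Strict Implicit.
Unset Printing Implicit Defensive.

Local Open Scope classical_set_scope.

Definition baire : Type := nat -> nat.

(* Partial recursive functions relative to a family of total oracles indexed
   by O; [O := void] gives the partial recursive functions, and [O := unit] the
   Turing functionals with one oracle. *)
Inductive code (O : Type) : nat -> Type :=
| Zero n : code O n
| Succ : code O 1
| Proj n : 'I_n -> code O n
| Oracle : O -> code O 1
| Comp m n : code O m -> ('I_m -> code O n) -> code O n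
| Prec n : code O n -> code O n.+2 -> code O n.+1
| Mu n : code O n.+1 -> code O n.

(* [eval r c xs y]: with oracles [r], [c] converges on [xs] with value [y].
   The recursion argument of Prec and the search argument of Mu come first;
   the step function of Prec receives the counter, the previous value and the
   parameters. *)
Fixpoint eval O (r : O -> baire) n (c : code O n) :
    n.-tuple nat -> nat -> Prop :=
  match c in code _ n return n.-tuple nat -> nat -> Prop with
  | Zero _ => fun _ y => y = 0
  | Succ => fun xs y => y = (thead xs).+1
  | Proj _ i => fun xs y => y = tnth xs i
  | Oracle o => fun xs y => y = r o (thead xs)
  | Comp m _ f g => fun xs y =>
      exists2 ys : m.-tuple nat,
        forall i, eval r (g i) xs (tnth ys i) & eval r f ys y
  | Prec _ f g => fun xs =>
      let ps := [tuple of behead xs] in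
      (fix prec k y :=
         if k is k'.+1
         then exists2 z, prec k' z & eval r g [tuple of k' :: z :: ps] y
         else eval r f ps y) (thead xs)
  | Mu _ f => fun xs y =>
      eval r f [tuple of y :: xs] 0 /\
      forall z, z < y -> exists v, eval r f [tuple of z :: xs] v.+1
  end.

Definition computable_seq (s : baire) : Prop :=
  exists c : code void 1, forall n, eval (@of_void baire) c [tuple n] (s n).

Definition computable_pmap (F : baire -> option baire) : Prop :=
  exists c : code unit 1, forall p q, F p = Some q ->
    forall n, eval (fun=> p) c [tuple n] (q n).

(* Sequences over N + {bot} are coded in N^N with 0 for bot and k+1 for k. *)
Definition enumerates (s : baire) (B : set nat) : Prop :=
  B = [set k | exists n, s n = k.+1].

Definition computably_enumerable (A : set nat) : Prop :=
  exists2 s, computable_seq s & enumerates s A.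

Record repspace : Type := RepSpace {
  point :> Type;
  delta : baire -> option point;
  delta_surj : forall x, exists p, delta p = Some x }.

Definition computable_map (X Y : repspace) (f : X -> Y) : Prop :=
  exists2 F, computable_pmap F &
    forall p x, delta X p = Some x ->
      exists2 q, F p = Some q & delta Y q = Some (f x).

Section Product.
Variables X Y : repspace.

Definition prod_delta (p : baire) : option (X * Y) :=
  match delta X (fun n => p n.*2), delta Y (fun n => p n.*2.+1) with
  | Some x, Some y => Some (x, y)
  | _, _ => None
  end.

Lemma prod_delta_surj xy : exists p, prod_delta p = Some xy.
Proof.
case: xy => x y.
have [p px] := delta_surj x; have [q qy] := delta_surj y.
exists (fun n => if odd n then q n./2 else p n./2); rewrite /prod_delta.
have -> : (fun n => if odd n.*2 then q n.*2./2 else p n.*2./2) = p.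
  by apply/funext => n; rewrite odd_double doubleK.
have -> : (fun n => if odd n.*2.+1 then q n.*2.+1./2 else p n.*2.+1./2) = q.
  by apply/funext => n; rewrite /= odd_double uphalf_double.
by rewrite px qy.
Qed.

Definition prod_space : repspace := RepSpace prod_delta_surj.

End Product.

(* The points top and bot are true and false. *)
Definition sierp_delta (p : baire) : option bool :=
  Some `[< p <> fun=> 0 >].

Lemma sierp_delta_surj b : exists p, sierp_delta p = Some b.
Proof.
exists (fun=> b : nat); congr Some; case: b; last by apply/asboolPn => /(_ erefl).
by apply/asboolP => /(congr1 (@^~ 0)).
Qed.

Definition sierpinski : repspace := RepSpace sierp_delta_surj.

Definition computably_open (X : repspace) (U : set X) : Prop :=
  @computable_map X sierpinski (fun x => `[< U x >]).

Definition computably_closed (X : repspace) (U : set X) : Prop :=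
  computably_open (~` U).

Definition computably_discrete (X : repspace) : Prop :=
  @computably_open (prod_space X X) diagonal.

Definition computably_Hausdorff (X : repspace) : Prop :=
  @computably_closed (prod_space X X) diagonal.

Definition finite_space (X : repspace) : Prop := finite_set [set: X].

Variant Hpoint : Type := Ha | Hb.

Section HSpace.
Variable A : set nat.

Definition H_delta (p : baire) : option Hpoint :=
  let n := p 0 in
  let s k := p k.+1 in
  if `[< ~ A n /\ enumerates s A >] then Some Ha
  else if `[< A n /\ exists2 B, B `<=` ~` A & enumerates s B >] then Some Hb
  else None.

Hypotheses (A0 : A !=set0) (AT : A <> setT).

Lemma H_delta_surj x : exists p, H_delta p = Some x.
Proof.
case: x.
- have /existsNP[n nA] : ~ forall n, A n.
    by move=> allA; apply: AT; apply/seteqP; split.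
  pose s k := if `[< A k >] then k.+1 else 0.
  exists (fun k => if k is k'.+1 then s k' else n).
  rewrite /H_delta ifT //; apply/asboolP; split => //; rewrite /enumerates.
  apply/seteqP; split => [k Ak|k [m]] /=.
    by exists k; rewrite /s asboolT.
  by rewrite /s; case: asboolP => // Am [<-].
- have [n An] := A0; exists (fun k => if k is 0 then n else 0).
  rewrite /H_delta ifF; last by apply/asboolPn => -[].
  rewrite ifT //; apply/asboolP; split => //; exists set0 => //.
  by apply/seteqP; split => // k [].
Qed.

Definition H_space : repspace := RepSpace H_delta_surj.

End HSpace.

Lemma not_ce_neq0 (A : set nat) : ~ computably_enumerable A -> A !=set0.
Proof.
move=> nA; apply/set0P/eqP => A0; apply: nA; exists (fun=> 0).
  by exists (Zero void 1).
by rewrite /enumerates A0; apply/seteqP; split => // k [].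
Qed.

Lemma not_ce_neqT (A : set nat) : ~ computably_enumerable A -> A <> setT.
Proof.
move=> nA AT; apply: nA; exists succn; first by exists (Succ void).
by rewrite /enumerates AT; apply/seteqP; split => // k _; exists k.
Qed.

(* Main.v *)
Require Import Defs.
From mathcomp Require Import all_boot.
From mathcomp Require Import boolp classical_sets cardinality.
From mathcomp Require Import zify.

(* Let the names (n, s) and (m, t) denote x and y in H_A. Then x and y differ
   iff m occurs in s or n occurs in t, which is semidecidable; so H_A is
   Hausdorff. If equality were semidecidable, fix m in A and run its acceptor
   on the computable sequences (n, empty enumeration), (m, empty enumeration).
   For n in A both name b, hence it accepts. For n outside A it cannot accept,
   since the finite part of the input that it has read could be continued by an
   enumeration of A, making the first component a name of a. Thus A would be
   computably enumerable. Dovetailing the acceptor over all n only requires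
   every single code to have a total computable fuel-bounded version, so that
   no universal machine is needed. *)

Set Implicit Arguments.
Unset Strict Implicit.
Unset Printing Implicit Defensive.

(** * Closure properties of total functions computable with oracles *)

Definition computable_fun O n (f : (O -> baire) -> n.-tuple nat -> nat) :=
  exists c : code O n, forall r xs, eval r c xs (f r xs).

Definition computable_tuple O n m
    (a : (O -> baire) -> n.-tuple nat -> m.-tuple nat) :=
  forall i, computable_fun (fun r xs => tnth (a r xs) i).

Lemma eq_computable O n (f g : (O -> baire) -> n.-tuple nat -> nat) :
  f =2 g -> computable_fun f -> computable_fun g.
Proof. by move=> fg [c cf]; exists c => r xs; rewrite -fg. Qed.

Section Closure.
Variables (O : Type) (n : nat).
Implicit Types (r : O -> baire) (xs : n.-tuple nat).
Implicit Types f g h : (O -> baire) -> n.-tuple nat -> nat.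

Lemma computable_proj i : computable_fun (fun r xs => tnth xs i).
Proof. by exists (Proj O i). Qed.

Lemma computable_comp m (f : (O -> baire) -> m.-tuple nat -> nat)
    (a : (O -> baire) -> n.-tuple nat -> m.-tuple nat) :
  computable_fun f -> computable_tuple a ->
  computable_fun (fun r xs => f r (a r xs)).
Proof.
move=> [c cf] /fin_all_exists[d da].
by exists (Comp c d) => r xs; exists (a r xs) => // i; exact: da.
Qed.

Lemma computable_cons m f (a : (O -> baire) -> n.-tuple nat -> m.-tuple nat) :
  computable_fun f -> computable_tuple a ->
  computable_tuple (fun r xs => [tuple of f r xs :: a r xs]).
Proof.
move=> cf ca i; case: (unliftP ord0 i) => [j|] ->.
  by apply: eq_computable (ca j) => r xs; rewrite tnthS.
by apply: eq_computable cf => r xs; rewrite tnth0.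
Qed.

Lemma computable_behead m
    (a : (O -> baire) -> n.-tuple nat -> m.+1.-tuple nat) :
  computable_tuple a -> computable_tuple (fun r xs => [tuple of behead (a r xs)]).
Proof.
by move=> ca i; apply: eq_computable (ca (inord i.+1)) => r xs; rewrite tnth_behead.
Qed.

Lemma computable_tuple_id : computable_tuple (fun r xs => xs).
Proof. by move=> i; exact: computable_proj. Qed.

Lemma computable_thead m
    (a : (O -> baire) -> n.-tuple nat -> m.+1.-tuple nat) :
  computable_tuple a -> computable_fun (fun r xs => thead (a r xs)).
Proof. exact. Qed.

Lemma computable_tuple_nil (a : (O -> baire) -> n.-tuple nat -> 0.-tuple nat) :
  computable_tuple a.
Proof. by case. Qed.

Lemma computable_succ f :
  computable_fun f -> computable_fun (fun r xs => (f r xs).+1).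
Proof.
move=> cf.
have cs : computable_fun (fun (_ : O -> baire) (ys : 1.-tuple nat) => (thead ys).+1).
  by exists (Succ O).
exact: (computable_comp cs (computable_cons cf (@computable_tuple_nil (fun _ _ => [tuple])))).
Qed.

Lemma computable_oracle o f :
  computable_fun f -> computable_fun (fun r xs => r o (f r xs)).
Proof.
move=> cf.
have co : computable_fun (fun (r : O -> baire) (ys : 1.-tuple nat) => r o (thead ys)).
  by exists (Oracle o).
exact: (computable_comp co (computable_cons cf (@computable_tuple_nil (fun _ _ => [tuple])))).
Qed.

Lemma computable_cst k : computable_fun (fun r xs => k).
Proof.
elim: k => [|k]; first by exists (Zero O n).
exact: computable_succ.
Qed.

(** [Prec] recurses on the head of its input. The code is therefore built for a tuple with one more
    entry, and composition then substitutes [h] for that entry. *)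
Lemma computable_rec f h (g : (O -> baire) -> nat -> nat -> n.-tuple nat -> nat) :
  computable_fun f -> computable_fun h ->
  computable_fun (fun r (ys : n.+2.-tuple nat) =>
    g r (thead ys) (thead [tuple of behead ys]) [tuple of behead (behead ys)]) ->
  computable_fun (fun r xs =>
    nat_rect (fun=> nat) (f r xs) (fun k z => g r k z xs) (h r xs)).
Proof.
move=> [c cf] ch [d dg].
have cp : computable_fun (fun r (ys : n.+1.-tuple nat) =>
    nat_rect (fun=> nat) (f r [tuple of behead ys])
      (fun k z => g r k z [tuple of behead ys]) (thead ys)).
  exists (Prec c d) => r ys /=; elim: (thead ys) => [|k ih] /=; first exact: cf.
  eexists; first exact: ih.
  set z := nat_rect _ _ _ _.
  have := dg r [tuple of k :: z :: behead ys].
  rewrite !theadE.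
  set t := [tuple of behead (behead _)].
  by have -> : t = [tuple of behead ys] by exact: val_inj.
apply: eq_computable (computable_comp cp (computable_cons ch computable_tuple_id)) => r xs.
by rewrite theadE; have -> : [tuple of behead [tuple of h r xs :: xs]] = xs
  by exact: val_inj.
Qed.

End Closure.

Section Substitution.
Variables (O : Type) (n : nat).
Implicit Types f g h : (O -> baire) -> n.-tuple nat -> nat.

Lemma computable_behead2 : computable_tuple
  (fun (_ : O -> baire) (ys : n.+2.-tuple nat) => [tuple of behead (behead ys)]).
Proof.
exact: (@computable_behead _ _ n _
  (@computable_behead _ _ n.+1 _ (@computable_tuple_id O n.+2))).
Qed.

Lemma computable_weaken2 f : computable_fun f ->
  computable_fun (fun r (ys : n.+2.-tuple nat) =>
    f r [tuple of behead (behead ys)]).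
Proof. by move=> cf; apply: (computable_comp cf); exact: computable_behead2. Qed.

Lemma computable_weaken f : computable_fun f ->
  computable_fun (fun r (ys : n.+1.-tuple nat) => f r [tuple of behead ys]).
Proof.
by move=> cf; apply: (computable_comp cf); exact/computable_behead/computable_tuple_id.
Qed.

Lemma computable_prev : computable_fun (fun (_ : O -> baire)
  (ys : n.+2.-tuple nat) => thead [tuple of behead ys]).
Proof. exact/computable_thead/computable_behead/computable_tuple_id. Qed.

(** Case analysis is a recursion whose step ignores the previous value. *)
Lemma computable_case f h
    (g : (O -> baire) -> nat -> n.-tuple nat -> nat) :
  computable_fun f -> computable_fun h ->
  computable_fun (fun r (ys : n.+1.-tuple nat) =>
    g r (thead ys) [tuple of behead ys]) ->
  computable_fun (fun r xs => if h r xs is k.+1 then g r k xs else f r xs).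
Proof.
move=> cf ch cg.
suff : computable_fun (fun r xs =>
    nat_rect (fun=> nat) (f r xs) (fun k _ => g r k xs) (h r xs)).
  by apply: eq_computable => r xs; case: (h r xs).
apply: (@computable_rec _ _ f h (fun r k _ xs => g r k xs)) => //.
have ca : computable_tuple (fun (_ : O -> baire) (ys : n.+2.-tuple nat) =>
    [tuple of thead ys :: behead (behead ys)]).
  apply: computable_cons; first exact: computable_proj.
  exact: computable_behead2.
apply: eq_computable (computable_comp cg ca) => r ys.
by rewrite theadE; congr g; exact: val_inj.
Qed.

Lemma computable_ifz f g h :
  computable_fun h -> computable_fun f -> computable_fun g ->
  computable_fun (fun r xs => if h r xs is 0 then f r xs else g r xs).
Proof.
move=> ch cf cg; apply: (@computable_case f h (fun r _ => g r)) => //.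
exact: computable_weaken.
Qed.

Lemma computable_pred f :
  computable_fun f -> computable_fun (fun r xs => (f r xs).-1).
Proof.
move=> cf; apply: eq_computable (@computable_case (fun _ _ => 0) f
  (fun _ k _ => k) (computable_cst _ _ _) cf (computable_proj _ _)) => r xs.
by case: (f r xs).
Qed.

End Substitution.

Section AddSub.
Variables (O : Type) (n : nat).
Implicit Types f g h : (O -> baire) -> n.-tuple nat -> nat.

Lemma computable_add f g : computable_fun f -> computable_fun g ->
  computable_fun (fun r xs => f r xs + g r xs).
Proof.
move=> cf cg.
apply: eq_computable (@computable_rec _ _ f g (fun _ _ z _ => z.+1) cf cg
  (computable_succ (computable_prev _ _))) => r xs.
by elim: (g r xs) => [|k /= ->]; rewrite ?addn0 ?addnS.
Qed.

Lemma computable_sub f g : computable_fun f -> computable_fun g ->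
  computable_fun (fun r xs => f r xs - g r xs).
Proof.
move=> cf cg.
apply: eq_computable (@computable_rec _ _ f g (fun _ _ z _ => z.-1) cf cg
  (computable_pred (computable_prev _ _))) => r xs.
by elim: (g r xs) => [|k /= ->]; rewrite ?subn0 ?subnS.
Qed.

End AddSub.

Lemma computable_mul O n (f g : (O -> baire) -> n.-tuple nat -> nat) :
  computable_fun f -> computable_fun g ->
  computable_fun (fun r xs => f r xs * g r xs).
Proof.
move=> cf cg.
have cM := @computable_rec _ _ (fun _ _ => 0) f (fun r _ z xs => z + g r xs)
  (computable_cst _ _ _) cf
  (computable_add (computable_prev _ _) (computable_weaken2 cg)).
apply: eq_computable cM => r xs.
by elim: (f r xs) => [|k /= ->]; rewrite ?mul0n // mulSn addnC.
Qed.

(** A finite product vanishes iff some factor does; [run] tests in this way whether all arguments of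
    a composition have a value. *)
Lemma computable_prod O n m (f : 'I_m -> (O -> baire) -> n.-tuple nat -> nat) :
  (forall i, computable_fun (f i)) ->
  computable_fun (fun r xs => \prod_(i < m) f i r xs).
Proof.
elim: m f => [|m ih] f cf.
  by apply: eq_computable (computable_cst _ _ 1) => r xs; rewrite big_ord0.
have cM := computable_mul (cf ord0) (ih _ (fun i => cf (lift ord0 i))).
by apply: eq_computable cM => r xs; rewrite big_ord_recl.
Qed.

(** * Fuel-bounded evaluation of codes *)

(* [0] means that the search is still going on, [1] that it met a [0] value of
   [f], i.e. a divergence, and [y.+2] that it stopped at [y]. *)
Definition search (f : nat -> nat) : nat -> nat :=
  nat_rect (fun=> nat) 0 (fun k z =>
    if z is 0 then if f k is v.+1 then if v is 0 then k.+2 else 0 else 1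
    else z).

Lemma computable_search O n (t : (O -> baire) -> n.-tuple nat -> nat)
    (f : (O -> baire) -> nat -> n.-tuple nat -> nat) :
  computable_fun t ->
  computable_fun (fun r (ys : n.+1.-tuple nat) =>
    f r (thead ys) [tuple of behead ys]) ->
  computable_fun (fun r xs => search (fun k => f r k xs) (t r xs)).
Proof.
move=> ct cf; apply: (@computable_rec _ _ (fun _ _ => 0) t (fun r k z xs =>
    if z is 0 then if f r k xs is v.+1 then if v is 0 then k.+2 else 0 else 1
    else z)) => //; first exact: computable_cst.
apply: computable_ifz; [exact: computable_prev| |exact: computable_prev].
pose f' r (ys : n.+2.-tuple nat) := f r (thead ys) [tuple of behead (behead ys)].
apply: (@computable_case _ _ (fun _ _ => 1) f'
    (fun _ v ys => if v is 0 then (thead ys).+2 else 0)).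
- exact: computable_cst.
- have ca := computable_cons (computable_proj O (@ord0 n.+1)) (@computable_behead2 O n).
  apply: eq_computable (computable_comp cf ca) => r ys.
  by rewrite theadE; congr f; exact: val_inj.
- apply: computable_ifz; [exact: computable_proj| |exact: computable_cst].
  apply: (@computable_weaken _ _ (fun r ys => (thead ys).+2)).
  by do 2!apply: computable_succ; exact: computable_proj.
Qed.

(** Here [f] returns values shifted by one, as [run] does: [1] stands for the value 0 that is
    sought, and anything larger for a nonzero value. *)
Lemma searchP f t : match search f t with
  | 0 => forall z, z < t -> 1 < f z
  | 1 => True
  | y.+2 => f y = 1 /\ forall z, z < y -> 1 < f z
  end.
Proof.
elim: t => [//|t] /=; case: (search f t) => [|[|y]] //= ih.
case E: (f t) => [|[|v]] // z; rewrite ltnS leq_eqVlt => /orP[/eqP ->|].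
  by rewrite E.
exact: ih.
Qed.

Lemma search_eq f y t : f y = 1 -> (forall z, z < y -> 1 < f z) -> y < t ->
  search f t = y.+2.
Proof.
move=> fy fz; have s0 k : k <= y -> search f k = 0.
  elim: k => //= k ih ky; rewrite ih ?(ltnW ky)//.
  by case: (f k) (fz k ky) => [|[]].
elim: t => // t ih; rewrite ltnS leq_eqVlt => /orP[/eqP <-|yt] /=.
  by rewrite s0 // fy.
by rewrite ih.
Qed.

(* [0] means that no value was found with fuel [t], which bounds only the
   unbounded searches, and [v.+1] that the value is [v]. *)
Fixpoint run O (t : nat) (r : O -> baire) n (c : code O n) :
    n.-tuple nat -> nat :=
  match c in code _ n return n.-tuple nat -> nat with
  | Zero _ => fun _ => 1
  | Succ => fun xs => (thead xs).+2
  | Proj _ i => fun xs => (tnth xs i).+1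
  | Oracle o => fun xs => (r o (thead xs)).+1
  | Comp m _ f g => fun xs =>
      if \prod_(i < m) run t r (g i) xs is 0 then 0
      else run t r f [tuple (run t r (g i) xs).-1 | i < m]
  | Prec _ f g => fun xs =>
      nat_rect (fun=> nat) (run t r f [tuple of behead xs])
        (fun k z => if z is z'.+1
                    then run t r g [tuple of k :: z' :: behead xs] else 0)
        (thead xs)
  | Mu _ f => fun xs => (search (fun k => run t r f [tuple of k :: xs]) t).-1
  end.

Lemma run_sound O t (r : O -> baire) n (c : code O n) xs v :
  run t r c xs = v.+1 -> eval r c xs v.
Proof.
elim: c xs v => {n} /=.
- by move=> n xs v [].
- by move=> xs v [].
- by move=> n i xs v [].
- by move=> o xs v [].
- move=> m n f ihf g ihg xs v.
  case E: (\prod_i _) => [//|k] /ihf fv.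
  exists [tuple (run t r (g i) xs).-1 | i < m] => // i; apply: ihg.
  rewrite tnth_mktuple prednK // lt0n; apply/eqP => g0.
  by move: E; rewrite (bigD1 i) //= g0.
- move=> n f ihf g ihg xs; elim: (thead xs) => [|k ih] v /=; first exact: ihf.
  case E: (nat_rect _ _ _ _) => [//|z] /ihg gv.
  by exists z => //; exact: ih.
- move=> n f ihf xs v.
  set s := fun k => _; have := searchP s t.
  (* The final [.-1] of [run] merges the outcomes [0] and [1] into having no value, so only [y.+2]
     remains. *)
  case: (search s t) => [//|[//|y]] [sy sz] [<-]; split; first exact: ihf.
  move=> z /sz; case E: (s z) => [|[|w]] // _.
  by exists w; exact: ihf.
Qed.

(** * Stability of convergence under nearby oracles and large fuel *)

Section Eventually.
Variables (O : Type) (r : O -> baire).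
Implicit Types P Q : (O -> baire) -> nat -> Prop.

(* For oracles close to [r] in Baire space and large fuel. *)
Definition eventually P := exists N, forall r' t,
  (forall o i, i < N -> r' o i = r o i) -> N <= t -> P r' t.

Lemma eventually_forall m (P : 'I_m -> (O -> baire) -> nat -> Prop) :
  (forall i, eventually (P i)) -> eventually (fun r' t => forall i, P i r' t).
Proof.
move=> /fin_all_exists[N PN]; exists (\max_i N i) => r' t r'r Nt i.
have Ni : N i <= \max_i N i by exact: leq_bigmax.
by apply: PN => [o j jN|]; [apply: r'r; exact: leq_trans Ni|exact: leq_trans Nt].
Qed.

Lemma eventually_and P Q : eventually P -> eventually Q ->
  eventually (fun r' t => P r' t /\ Q r' t).
Proof.
move=> [N PN] [M QM]; exists (maxn N M) => r' t r'r.
rewrite geq_max => /andP[Nt Mt].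
by split; [apply: PN|apply: QM] => // o i im; apply: r'r;
  rewrite leq_max im ?orbT.
Qed.

Lemma eventually_imp P Q : (forall r' t, P r' t -> Q r' t) ->
  eventually P -> eventually Q.
Proof. by move=> PQ [N PN]; exists N => r' t r'r Nt; exact/PQ/PN. Qed.

Lemma eventually_fuel k : eventually (fun _ t => k <= t).
Proof. by exists k. Qed.

Lemma eventually_use o i : eventually (fun r' _ => r' o i = r o i).
Proof. by exists i.+1 => r' t + _; apply. Qed.

End Eventually.

(** A converging computation consults finitely many oracle entries and makes finitely many
    terminating searches, so one bound serves for both oracle and fuel. *)
Lemma run_complete O (r : O -> baire) n (c : code O n) xs v :
  eval r c xs v -> eventually r (fun r' t => run t r' c xs = v.+1).
Proof.
elim: c xs v => {n} /=.
- by move=> n xs v ->; exists 0.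
- by move=> xs v ->; exists 0.
- by move=> n i xs v ->; exists 0.
- move=> o xs v ->; apply: eventually_imp (eventually_use r o (thead xs)).
  by move=> r' t ->.
- move=> m n f ihf g ihg xs v [ys /(_ _)/ihg gys /ihf fv].
  apply: eventually_imp (eventually_and fv (eventually_forall gys)).
  move=> r' t [fE gE].
  have -> : [tuple (run t r' (g i) xs).-1 | i < m] = ys.
    by apply: eq_from_tnth => i; rewrite tnth_mktuple gE.
  have : 0 < \prod_(i < m) run t r' (g i) xs.
    by rewrite prodn_gt0 // => i; rewrite gE.
  by case: (\prod_i _).
- move=> n f ihf g ihg xs; elim: (thead xs) => [|k ih] v; first exact: ihf.
  move=> [z /ih zE /ihg vE]; apply: eventually_imp (eventually_and zE vE).
  move=> r' t [/= -> <-]; congr run; exact: val_inj.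
- move=> n f ihf xs y [/ihf fy fz].
  (* The failures below [y] form a finite conjunction, hence admit a common bound. *)
  have fz' (z : 'I_y) : eventually r (fun r' t => 1 < run t r' f [tuple of val z :: xs]).
    have [w /ihf] := fz z (ltn_ord z).
    by apply: eventually_imp => r' t ->.
  apply: eventually_imp (eventually_and (eventually_fuel r y.+1)
    (eventually_and fy (eventually_forall fz'))).
  move=> r' t [yt [fE fzE]]; rewrite (@search_eq _ y) // => z zy.
  exact: (fzE (Ordinal zy)).
Qed.

(** Both values are the result of the function [run] for one large fuel. *)
Lemma eval_inj O (r : O -> baire) n (c : code O n) xs v w :
  eval r c xs v -> eval r c xs w -> v = w.
Proof.
move=> /run_complete cv /run_complete cw.
have [N /(_ r N)] := eventually_and cv cw.
by case=> // -> [].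
Qed.

(** The use principle: completeness bounds the part of the oracle consulted, and soundness leads
    back from [run] to [eval]. *)
Lemma eval_use O (r : O -> baire) n (c : code O n) xs v :
  eval r c xs v -> exists N, forall r',
  (forall o i, i < N -> r' o i = r o i) -> eval r' c xs v.
Proof.
move=> /run_complete[N cN]; exists N => r' r'r.
by apply: (@run_sound _ N); exact: cN.
Qed.

(** * Computability of the fuel-bounded evaluation *)

Section RunComputable.
Variables (O O' : Type) (w : nat -> O -> baire).
Hypothesis cw : forall o n (a x : (O' -> baire) -> n.-tuple nat -> nat),
  computable_fun a -> computable_fun x ->
  computable_fun (fun r xs => w (a r xs) o (x r xs)).

(** With fuel, every clause is a composition, a recursion or a bounded search, so induction on the
    fixed code [c] suffices. Oracle calls become calls of the computable family [w]. *)
Lemma computable_run n (c : code O n) m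
    (t a : (O' -> baire) -> m.-tuple nat -> nat)
    (b : (O' -> baire) -> m.-tuple nat -> n.-tuple nat) :
  computable_fun t -> computable_fun a -> computable_tuple b ->
  computable_fun (fun r xs => run (t r xs) (w (a r xs)) c (b r xs)).
Proof.
elim: c m t a b => {n} /=.
- by move=> *; exact: computable_cst.
- by move=> m t a b ct ca cb; do 2! apply: computable_succ; exact: computable_thead.
- by move=> n i m t a b ct ca cb; apply: computable_succ; exact: cb.
- move=> o m t a b ct ca cb; apply: computable_succ; apply: cw => //.
  exact: computable_thead.
- move=> m n f ihf g ihg k t a b ct ca cb.
  apply: computable_ifz; first by apply: computable_prod => i; exact: ihg.
    exact: computable_cst.
  apply: (ihf k t a (fun r xs => [tuple (run (t r xs) (w (a r xs)) (g i) (b r xs)).-1 | i < m])) => // i.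
  apply: eq_computable (computable_pred (ihg i _ _ _ _ ct ca cb)) => r xs.
  by rewrite tnth_mktuple.
- move=> n f ihf g ihg m t a b ct ca cb.
  apply: (@computable_rec _ _ (fun r xs => run (t r xs) (w (a r xs)) f [tuple of behead (b r xs)])
   (fun r xs => thead (b r xs))
   (fun r k z xs => if z is z'.+1 then run (t r xs) (w (a r xs)) g
       [tuple of k :: z' :: behead (b r xs)] else 0)).
  + by apply: (ihf _ _ _ (fun r xs => [tuple of behead (b r xs)])) => //; exact: computable_behead.
  + exact: computable_thead.
  + pose bb n := fun ys : n.+2.-tuple nat => [tuple of behead (behead ys)].
    pose g' r z' (ys : m.+2.-tuple nat) :=
      run (t r (bb _ ys)) (w (a r (bb _ ys))) g
        [tuple of thead ys :: z' :: behead (b r (bb _ ys))].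
    apply: (@computable_case _ _ (fun _ _ => 0) _ g').
    * exact: computable_cst.
    * exact: computable_prev.
    (* The entries of [zs] are the predecessor of the previous value, the counter, the previous
       value and the parameters. *)
    * pose b' r (zs : m.+3.-tuple nat) :=
        [tuple of thead [tuple of behead zs] :: [tuple of thead zs ::
          [tuple of behead (b r (bb _ [tuple of behead zs]))]]].
      have ci : computable_tuple b'.
        apply: computable_cons.
          apply: (@computable_weaken _ _ (fun _ ys => thead ys)).
          exact: computable_proj.
        apply: computable_cons; first exact: computable_proj.
        apply: computable_behead => i.
        apply: (computable_weaken (f := fun r ys => tnth (b r (bb _ ys)) i)).
        exact: (computable_weaken2 (cb i)).
      have ct' := computable_weaken (computable_weaken2 ct).
      have ca' := computable_weaken (computable_weaken2 ca).
      apply: eq_computable (ihg _ _ _ _ ct' ca' ci) => r zs.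
      by congr run; exact: val_inj.
- move=> n f ihf m t a b ct ca cb; apply: computable_pred.
  apply: (@computable_search _ _ t
    (fun r k xs => run (t r xs) (w (a r xs)) f [tuple of k :: b r xs])) => //.
  apply: ihf; try exact: computable_weaken.
  exact: (computable_cons (computable_proj _ ord0)
    (a := fun r (ys : m.+1.-tuple nat) => b r [tuple of behead ys])
    (fun i => computable_weaken (cb i))).
Qed.

End RunComputable.

(** * Dovetailing and the enumerability of halting sets *)

(* The reset times are the numbers [2 ^ i - 1], so that [offset j] runs through
   ever longer initial segments of [nat]. *)
Definition last_reset : nat -> nat :=
  nat_rect (fun=> nat) 0 (fun k z => if 2 * z - k is 0 then k.+1 else z).

Definition offset j := j - last_reset j.

(** A reset time [z] is kept up to stage [2 * z] and then replaced by [2 * z + 1], which takes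
    [2 ^ i - 1] to [2 ^ i.+1 - 1]. *)
Lemma last_reset_exp i n : n < 2 ^ i -> last_reset ((2 ^ i).-1 + n) = (2 ^ i).-1.
Proof.
elim: i n => [[]//|i ihi]; have i0 : 0 < 2 ^ i by rewrite expn_gt0.
elim=> [_|n ihn nlt].
  have -> : (2 ^ i.+1).-1 + 0 = ((2 ^ i).-1 + (2 ^ i).-1).+1 by rewrite expnS; lia.
  rewrite /= -/(last_reset _) ihi; last by rewrite ltn_predL.
  by rewrite addnn mul2n subnn expnS; lia.
rewrite addnS /= -/(last_reset _) ihn; last exact: ltnW.
by case E: (_ - _) => //; lia.
Qed.

(** Since every input recurs at arbitrarily late stages, a stage [j] can be the fuel and select the
    input [offset j] at once, in place of a pairing function. *)
Lemma offset_io n m : exists2 j, m <= j & offset j = n.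
Proof.
have nm : n + m < 2 ^ (n + m) by exact: ltn_expl.
(* The block starting at [2 ^ (n + m) - 1] lies beyond [m] and is long enough to contain offset
   [n]. *)
exists ((2 ^ (n + m)).-1 + n); first lia.
by rewrite /offset last_reset_exp; lia.
Qed.

Lemma computable_offset O n (f : (O -> baire) -> n.-tuple nat -> nat) :
  computable_fun f -> computable_fun (fun r xs => offset (f r xs)).
Proof.
move=> cf; apply: computable_sub => //.
apply: (@computable_rec _ _ (fun _ _ => 0) f
  (fun _ k z _ => if 2 * z - k is 0 then k.+1 else z)) => //.
  exact: computable_cst.
have cz := @computable_prev O n; have ck := computable_proj O (@ord0 n.+1).
apply: computable_ifz => //; last exact: computable_succ.
by apply: computable_sub => //; apply: computable_mul => //; exact: computable_cst.
Qed.

(* In the interleaved coding of pairs: [n] and [m], each followed by the empty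
   enumeration. *)
Definition pair_name m n : baire :=
  fun i => if i is i'.+1 then if i' is 0 then m else 0 else n.

Lemma computable_pair_name O m k (a x : (O -> baire) -> k.-tuple nat -> nat) :
  computable_fun a -> computable_fun x ->
  computable_fun (fun r xs => pair_name m (a r xs) (x r xs)).
Proof.
move=> ca cx.
apply: (@computable_case _ _ a x (fun _ i' _ => if i' is 0 then m else 0)) => //.
by apply: computable_ifz; [exact: computable_proj| |]; exact: computable_cst.
Qed.

(** Stage [j] runs [c] for the input [offset j] with fuel [j], and lists this input if a value is
    found. *)
Lemma halting_ce m (c : code unit 0) : computably_enumerable
  [set n | exists v, eval (fun=> pair_name m n) c [tuple] v].
Proof.
pose g t n := run t (fun=> pair_name m n) c [tuple].
exists (fun j => if g j (offset j) is 0 then 0 else (offset j).+1); last first.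
  apply/seteqP; split => [n [v /run_complete[N cN]]|n [j] /=].
    have [j Nj jn] := offset_io n N; exists j.
    by rewrite jn /g cN.
  case E: (g _ _) => [//|v] [<-]; exists v; exact: run_sound E.
have cj : computable_fun (fun (_ : void -> baire) (xs : 1.-tuple nat) => thead xs).
  exact: computable_proj.
have co := computable_offset cj.
have [|d dE] := computable_ifz _ (computable_cst _ _ 0) (computable_succ co)
  (h := fun _ xs => g (thead xs) (offset (thead xs))).
  apply: (@computable_run _ _ (fun n (_ : unit) => pair_name m n)
    _ _ _ _ _ _ (fun _ _ => [tuple])) => //.
    by move=> _ n a x; exact: computable_pair_name.
  exact: computable_tuple_nil.
by exists d => n; exact: dE.
Qed.

(** * Names in [H_space] and in products *)

Section HSpace.
Variable A : set nat.

Lemma H_delta_Ha p : H_delta A p = Some Ha <->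
  ~ A (p 0) /\ enumerates (fun k => p k.+1) A.
Proof.
rewrite /H_delta; case: asboolP => // h; split => //.
by case: asboolP.
Qed.

Lemma H_delta_Hb p : H_delta A p = Some Hb <->
  A (p 0) /\ forall k n, p k.+1 = n.+1 -> ~ A n.
Proof.
rewrite /H_delta; case: asboolP => [[nAp eA]|_]; first by split => // -[].
case: asboolP => [[Ap [B BA eB]]|h]; split => //.
  by move=> _; split => // k n pk; apply: BA; rewrite eB; exists k.
case=> Ap pA; case: h; split => //.
by exists [set n | exists k, p k.+1 = n.+1]%classic => // n [k] /pA.
Qed.

End HSpace.

Lemma prod_delta_Some (X Y : repspace) p (x : X) (y : Y) :
  delta (prod_space X Y) p = Some (x, y) <->
  delta X (fun n => p n.*2) = Some x /\ delta Y (fun n => p n.*2.+1) = Some y.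
Proof.
rewrite /= /prod_delta.
case: (delta X _) => [x'|]; last by split=> // -[].
case: (delta Y _) => [y'|]; last by split=> // -[].
by split=> [[-> ->]|[[->] [->]]].
Qed.

(** * Finiteness, the Hausdorff property and failure of discreteness *)

Section Corollary.
Variables (A : set nat) (nA : ~ computably_enumerable A).
Let HA := H_space (not_ce_neq0 nA) (not_ce_neqT nA).

Lemma H_finite : finite_space HA.
Proof.
apply: (sub_finite_set (B := [set Ha; Hb]%classic : set HA)).
  by move=> [] _; [left|right].
exact: finite_set2.
Qed.

Lemma H_Hausdorff : computably_Hausdorff HA.
Proof.
(* [d] is the distance, so [1 - d] tests equality. The leading numbers are [p 0] and [p 1]; their
   successors are the codes to be found in the opposite enumeration. *)
pose d a b := a - b + (b - a).
pose G (p : baire) k :=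
  (1 - d (p (2 * k.+1)) (p 1).+1) + (1 - d (p (2 * k.+1).+1) (p 0).+1).
have GP p k : G p k <> 0 <-> p (k.+1.*2) = (p 1).+1 \/ p (k.+1.*2.+1) = (p 0).+1.
  by rewrite /G /d !mul2n; lia.
exists (fun p => Some (G p)).
  have [c cG] : computable_fun (fun (r : unit -> baire) (xs : 1.-tuple nat) =>
      G (r tt) (thead xs)).
    have ck := computable_proj unit (@ord0 0).
    have c2 := computable_mul (computable_cst _ _ 2) (computable_succ ck).
    have cd a b : computable_fun a -> computable_fun b -> computable_fun
        (fun (r : unit -> baire) (xs : 1.-tuple nat) => 1 - d (a r xs) (b r xs)).
      move=> ca cb; apply: computable_sub; first exact: computable_cst.
      by apply: computable_add; exact: computable_sub.
    apply: computable_add; apply: cd.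
    - exact: computable_oracle c2.
    - exact/computable_succ/(computable_oracle tt)/computable_cst.
    - exact/(computable_oracle tt)/computable_succ.
    - exact/computable_succ/(computable_oracle tt)/computable_cst.
  by exists c => p _ [<-] n; exact: (cG (fun=> p) [tuple n]).
move=> p [x y] /prod_delta_Some[px py].
exists (G p) => //; rewrite /sierp_delta; congr Some.
have G0 : G p <> (fun=> 0) <-> exists k, G p k <> 0.
  split; last by move=> [k Gk] G0; apply: Gk; rewrite G0.
  by move=> Gn; apply: contrapT => /forallNP h; apply: Gn; apply/funext => k;
    apply: contrapT.
apply: asbool_equiv_eq; rewrite G0 /=.
(* For equal points, each enumeration avoids the leading number of the other name. Otherwise the
   enumeration of [A] in the name of [Ha] meets the leading number in the name of [Hb]. *)
case: x px => px; case: y py => py; move: px py.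
- move=> /H_delta_Ha[/= n0 n1] /H_delta_Ha[/= m0 m1].
  split=> [[k /GP[]pk]|]; last by case.
    by case: m0; rewrite n1; exists k.
  by case: n0; rewrite m1; exists k.
- move=> /H_delta_Ha[/= n0 n1] /H_delta_Hb[/= m0 m1].
  split=> // _; move: m0; rewrite n1 => -[k pk]; exists k.
  by apply/GP; left.
- move=> /H_delta_Hb[/= m0 m1] /H_delta_Ha[/= n0 n1].
  split=> // _; move: m0; rewrite n1 => -[k pk]; exists k.
  by apply/GP; right.
- move=> /H_delta_Hb[/= n0 n1] /H_delta_Hb[/= m0 m1].
  split=> [[k /GP[]pk]|]; last by case.
    by case: (n1 _ _ pk).
  by case: (m1 _ _ pk).
Qed.

Lemma H_not_discrete : ~ computably_discrete HA.
Proof.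
case=> F [c cF] FP; have [m Am] := not_ce_neq0 nA.
(* [Mu] looks for zeros, and [1 - q k] is zero iff [q k] is not; so [c0] halts iff the acceptor
   answers top. *)
have [z zE] : computable_fun (fun (_ : unit -> baire) (xs : 1.-tuple nat) =>
    1 - thead xs).
  by apply: computable_sub; [exact: computable_cst|exact: computable_proj].
pose c0 := Mu (Comp z (fun=> c)).
apply: nA; suff -> : A = [set n | exists v, eval (fun=> pair_name m n) c0 [tuple] v]%classic.
  exact: halting_ce.
have c0E p q : F p = Some q ->
    forall k, eval (fun=> p) (Comp z (fun=> c)) [tuple k] (1 - q k).
  move=> Fp k; exists [tuple q k]; last exact: zE.
  by move=> i; rewrite (ord1 i); exact: (cF p).
(* Only the odd entries are constrained, so that this also covers the modified name [p] below. *)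
have odd_name n (p : baire) : (forall i, p i.*2.+1 = pair_name m n i.*2.+1) ->
    H_delta A (fun i => p i.*2.+1) = Some Hb.
  by move=> pE; apply/H_delta_Hb; split=> [|k l]; rewrite pE.
apply/seteqP; split => n /=.
- move=> An; have [|q Fq] := FP (pair_name m n) (Hb, Hb).
    apply/prod_delta_Some; split; last exact: (odd_name n).
    by apply/H_delta_Hb; split.
  rewrite /= asboolT // => -[/asboolP qn0].
  have qk : exists k, q k != 0.
    apply: contrapT => /forallNP h; apply: qn0; apply/funext => k.
    by apply/eqP; apply: contrapT => /negP /h.
  case: (ex_minnP qk) => k qk0 kmin; exists k; split.
    have /(_ k) := c0E _ _ Fq.
    by have /eqP -> : 1 - q k == 0 by rewrite subn_eq0 lt0n.
  (* Before the least [k] the tested value is [1 - 0], the successor of [0]. *)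
  move=> l lk; exists 0; have /(_ l) := c0E _ _ Fq.
  suff -> : q l = 0 by [].
  by apply/eqP; apply: contraTT lk => /kmin; rewrite leqNgt.
- move=> [v [[ys cy zy] _]].
  have [N NP] := eval_use (cy ord0).
  apply: contrapT => nAn.
  (* [p] continues the part of [pair_name m n] read by [c] with an enumeration
     of [A] in the first component. *)
  pose p i := if odd i || (i < N.+2) then pair_name m n i
    else let j := i./2 - N.+1 in if `[< A j >] then j.+1 else 0.
  have [|q Fq] := FP p (Ha, Hb).
    apply/prod_delta_Some; split; last first.
      by apply: (odd_name n) => i; rewrite /p /= odd_double.
    (* The bound [N.+2] is positive, so the leading number is still [n]. The other retained entries
       of this component are [0], and the term of index [j + N] lies past them and decides whether
       to list [j]. *)
    apply/H_delta_Ha; split => //; apply/seteqP; split => j /=.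
      move=> Aj; exists (j + N); rewrite /p odd_double doubleK ifF; last lia.
      by rewrite subSS addnK /= asboolT.
    move=> [k]; rewrite /p odd_double /=.
    by case: ifP => // _; case: asboolP => // Aj [<-].
  rewrite /= asboolF; last by [].
  move=> -[/asboolPn/contrapT q0].
  (* As [p] agrees with [pair_name m n] on the entries used, [c] gives at [v] the same nonzero value
     that stopped the search, whereas [q] is constantly [0]. *)
  have cv : eval (fun=> p) c [tuple v] (tnth ys ord0).
    by apply: NP => _ i iN; rewrite /p ltnW ?orbT // ltnW.
  have := eval_inj cv (cF _ _ Fq v).
  rewrite q0; have := eval_inj zy (zE (fun=> pair_name m n) ys).
  by rewrite /thead; case: (tnth ys ord0).
Qed.

End Corollary.

Theorem corollary36 (A : set nat) (nA : ~ computably_enumerable A) :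
  let HA := H_space (not_ce_neq0 nA) (not_ce_neqT nA) in
  finite_space HA /\ computably_Hausdorff HA /\ ~ computably_discrete HA.
Proof.
split; first exact: H_finite.
split; [exact: H_Hausdorff|exact: H_not_discrete].
Qed.
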